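(* For every integer $n\geq 3$, the polynomials $D_n^+(s,t)$ and $D_n^-(s,t)$ are gamma non-negative, i.e. each can be written as $\sum_{i=0}^{\lfloor n/2\rfloor}\gamma_i(st)^i(s+t)^{n-2i}$ with all $\gamma_i\geq0$.
   Context: $\mathfrak{B}_n$ is the group of signed permutations $w=w_1\cdots w_n$ of $\{\pm1,\dots,\pm n\}$ ($w(-i)=-w(i)$), and $\mathfrak{D}_n\subseteq\mathfrak{B}_n$ the subset with an even number of negative entries. For $w\in\mathfrak{D}_n$: $\mathsf{inv}_D(w)=|\{1\le i<j\le n:w_i>w_j\}|+|\{1\le i<j\le n:-w_i>w_j\}|$; $\mathsf{des}_D(w)=|\{i\in[n-1]:w_i>w_{i+1}\}|+\chi(w_1+w_2<0)$, where $\chi$ is the $0/1$ indicator; $\mathsf{asc}_D(w)=n-\mathsf{des}_D(w)$. $\mathfrak{D}_n^+=\{w\in\mathfrak{D}_n:\mathsf{inv}_D(w)\text{ even}\}$, $\mathfrak{D}_n^-=\mathfrak{D}_n\setminus\mathfrak{D}_n^+$, and $D_n^{\pm}(s,t)=\sum_{w\in\mathfrak{D}_n^{\pm}}t^{\mathsf{des}_D(w)}s^{\mathsf{asc}_D(w)}$. *)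

(* Defs.v *)
From mathcomp Require Import all_boot all_order all_algebra all_fingroup.
From mathcomp Require Import mpoly.

Set Implicit Arguments.
Unset Strict Implicit.
Unset Printing Implicit Defensive.

Import Order.TTheory GRing.Theory Num.Theory.
Local Open Scope ring_scope.

(* The set {1,-1,...,n,-n}: the pair (b, i) stands for i+1 if b = false and    *)
(* for -(i+1) if b = true.                                                     *)
Notation pm n := (bool * 'I_n)%type.

Definition pm_opp n (x : pm n) : pm n := (~~ x.1, x.2).

Definition pm_int n (x : pm n) : int :=
  if x.1 then - (x.2.+1)%:Z else (x.2.+1)%:Z.

Definition signed_perms n : {set {perm (pm n)}} :=
  [set w : {perm (pm n)} | [forall x, w (pm_opp x) == pm_opp (w x)]].

Lemma signed_perms_group_set n : group_set (signed_perms n).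
Proof.
apply/group_setP; split; first by rewrite inE; apply/forallP=> x; rewrite !perm1.
move=> u v; rewrite !inE => /forallP uP /forallP vP; apply/forallP=> x.
by rewrite !permM (eqP (uP x)) (eqP (vP _)).
Qed.

Canonical signed_perms_group n := Group (signed_perms_group_set n).

(* One-line notation w_1 ... w_n, indexed from 0: (one_line w)`_i is w_(i+1).  *)
Definition one_line n (w : {perm (pm n)}) : seq int :=
  [seq pm_int (w (false, i)) | i <- enum 'I_n].

Definition negs n (w : {perm (pm n)}) : nat :=
  #|[set i : 'I_n | (one_line w)`_i < 0]|.

Definition Dset n : {set {perm (pm n)}} :=
  [set w in signed_perms n | ~~ odd (negs w)].

Definition invD n (w : {perm (pm n)}) : nat :=
  (#|[set p : 'I_n * 'I_n
       | (p.1 < p.2)%N & ((one_line w)`_p.1 > (one_line w)`_p.2)%R]| +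
   #|[set p : 'I_n * 'I_n
       | (p.1 < p.2)%N & (- (one_line w)`_p.1 > (one_line w)`_p.2)%R]|)%N.

(* Meaningful only for n >= 2, where w_1 and w_2 both exist.                   *)
Definition desD n (w : {perm (pm n)}) : nat :=
  (#|[set i : 'I_n.-1 | ((one_line w)`_i > (one_line w)`_i.+1)%R]| +
   ((one_line w)`_0 + (one_line w)`_1 < 0)%R)%N.

(* No truncation occurs, since desD w <= n for n >= 1.                         *)
Definition ascD n (w : {perm (pm n)}) : nat := (n - desD w)%N.

Definition Dplus n : {set {perm (pm n)}} := [set w in Dset n | ~~ odd (invD w)].
Definition Dminus n : {set {perm (pm n)}} := Dset n :\: Dplus n.

Definition var_s : {mpoly rat[2]} := 'X_(0 : 'I_2).
Definition var_t : {mpoly rat[2]} := 'X_(1 : 'I_2).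

Definition Dpoly_plus n : {mpoly rat[2]} :=
  \sum_(w in Dplus n) var_t ^+ desD w * var_s ^+ ascD w.

Definition Dpoly_minus n : {mpoly rat[2]} :=
  \sum_(w in Dminus n) var_t ^+ desD w * var_s ^+ ascD w.

Definition gamma_nonneg (n : nat) (f : {mpoly rat[2]}) : Prop :=
  exists gamma : 'I_(n./2).+1 -> rat,
    (forall i, 0 <= gamma i) /\
    f = \sum_(i < (n./2).+1)
          gamma i *: ((var_s * var_t) ^+ i * (var_s + var_t) ^+ (n - 2 * i)%N).

(* Main.v *)
Require Import Defs.
From mathcomp Require Import all_boot all_order all_algebra all_fingroup.
From mathcomp Require Import mpoly ring zify.

(** Write [w] as a permutation [p = |w|] together with a choice of signs.  Each
    comparison counted by [des_D] is decided by the sign of the entry of larger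
    absolute value, so for fixed [p] the sum of [t^des s^asc] over all signs is a
    product of local factors: with [u = s + t] and [v = s t], a position
    contributes [2 v], [u] or [2] if it is a peak, on a slope, or a valley of [p],
    and the first two positions jointly contribute [2 (u^2 - 2 v)] if
    [p_1 < p_2 < p_3], [4 v] if [p_1 > p_2 < p_3] and [2 u v] if [p_2 > p_3].
    Even sign choices give exactly half of this sum, and the parity of [inv_D] is
    the parity of [p].  The only negative terms, [-4 v] times the remaining
    factors, occur for [p_1 < p_2 < p_3]; they cancel against terms with
    [p_1 > p_2 < p_3] along a parity-preserving injection that keeps the product
    of the remaining factors: [a b c ... |-> c a b ...] in general, and
    [a b d c ... |-> c a d b ...] when the fourth entry is a valley (or a final
    descent) with value between the second and the third. *)

Set Implicit Arguments.
Unset Strict Implicit.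
Unset Printing Implicit Defensive.

Import Order.TTheory GRing.Theory Num.Theory.
Local Open Scope ring_scope.

(** * Local sign sums and their products *)

Section SiteWeights.
Variables (K : comNzRingType) (s t : K).

Definition step_weight (d : bool) : K := if d then t else s.

Definition site_weight (asc desc : bool) : K :=
  \sum_(b : bool) (if asc then step_weight b else 1) *
                  (if desc then step_weight (~~ b) else 1).

Lemma site_weightE asc desc : site_weight asc desc =
  if asc then if desc then s * t *+ 2 else s + t
  else if desc then s + t else 1 *+ 2.
Proof.
rewrite /site_weight big_bool /step_weight.
by case: asc; case: desc => /=; ring.
Qed.

Lemma prod_step_weight k (d : nat -> bool) :
  \prod_(i < k) step_weight (d i) =
  t ^+ (\sum_(i < k) d i)%N * s ^+ (k - \sum_(i < k) d i)%N.
Proof.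
elim: k => [|k IH]; first by rewrite !big_ord0 !expr0 mulr1.
have le_k : (\sum_(i < k) d i <= k)%N.
  rewrite -[leqRHS]card_ord -sum1_card.
  by apply: leq_sum => i _; case: (d i).
rewrite !big_ord_recr /= IH /step_weight; case: (d k) => /=.
  by rewrite addn1 subSS exprSr; ring.
by rewrite addn0 subSn // exprSr; ring.
Qed.

Definition desc_at (n : nat) (p : nat -> nat) (j : nat) : bool :=
  (j.+1 < n)%N && (p j.+1 < p j)%N.

(* [step_weight] collected over the comparisons decided by the sign [b] of entry
   [j]; the last factor is the comparison of [w_1 + w_2] with [0]. *)
Definition position_weight (n : nat) (p : nat -> nat) (j : nat) (b : bool) : K :=
  (if (0 < j)%N && (p j.-1 < p j)%N then step_weight b else 1) *
  (if desc_at n p j then step_weight (~~ b) else 1) *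
  (if j == (p 0%N < p 1%N)%N :> nat then step_weight b else 1).

(** Each adjacent comparison is charged to its end of larger absolute value: the right end where [p]
    ascends, the left end otherwise. *)
Lemma prod_position_weight m (p : nat -> nat) (e : nat -> bool) :
  (forall i, (i < m.+1)%N -> p i != p i.+1) ->
  \prod_(j < m.+2) position_weight m.+2 p j (e j) =
  \prod_(i < m.+1) step_weight (if (p i < p i.+1)%N then e i.+1 else ~~ e i) *
  step_weight (e (p 0%N < p 1%N)%N).
Proof.
move=> p_neq; rewrite 2!big_split /=; congr (_ * _).
  (* Position 0 has no left neighbour and the last position no right one; dropping these two trivial
     factors indexes both products by the adjacent pairs. *)
  rewrite big_ord_recl /= mul1r [X in _ * X]big_ord_recr /= /desc_at ltnn mulr1.
  rewrite -big_split; apply: eq_bigr => i _ /=.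
  rewrite /bump /= add1n add0n ltnS ltn_ord /=.
  by case: ltngtP (p_neq i (ltn_ord i)) => //=; rewrite ?mulr1 ?mul1r.
have le1 : ((p 0%N < p 1%N)%N < m.+2)%N by case: (p 0%N < p 1%N)%N.
by rewrite -big_mkcond (big_pred1 (Ordinal le1)) // => j; rewrite -val_eqE.
Qed.

(* The sum weighted by (-1)^(number of negative signs) also factors, and its
   factor at position 0 vanishes. *)
Lemma sum_even_signs n (g : 'I_n.+1 -> bool -> K) :
  g ord0 true = g ord0 false ->
  (\sum_(e : {ffun 'I_n.+1 -> bool} | ~~ odd (\sum_j e j))
     \prod_j g j (e j)) *+ 2 = \prod_j \sum_(b : bool) g j b.
Proof.
move=> g0.
have sgn0 : \sum_(e : {ffun 'I_n.+1 -> bool})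
    (-1) ^+ (\sum_j e j)%N * \prod_j g j (e j) = 0.
  transitivity (\prod_j \sum_(b : bool) (-1) ^+ b * g j b).
    rewrite bigA_distr_bigA; apply: eq_bigr => e _.
    by rewrite big_split /= prodrXr.
  by rewrite big_ord_recl big_bool g0 /= expr1 expr0; ring.
rewrite bigA_distr_bigA /= -[RHS]addr0 -[X in _ = _ + X]sgn0 -big_split big_mkcond -sumrMnl /=.
apply: eq_bigr => e _; rewrite -signr_odd.
by case: odd => /=; ring.
Qed.

Definition tail_weight (n : nat) (p : nat -> nat) : K :=
  \prod_(2 <= j < n) site_weight (p j.-1 < p j)%N (desc_at n p j).

Lemma prod_sum_position_weight m (p : nat -> nat) : p 0%N != p 1%N ->
  \prod_(j < m.+3) \sum_(b : bool) position_weight m.+3 p j b =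
  tail_weight m.+3 p *
  (if (p 2%N < p 1%N)%N then s * t * (s + t) *+ 2
   else if (p 0%N < p 1%N)%N then ((s + t) ^+ 2 - s * t *+ 2) *+ 2
   else s * t *+ 4).
Proof.
move=> p01; rewrite -(big_mkord xpredT
  (fun j => \sum_(b : bool) position_weight m.+3 p j b)).
rewrite big_ltn // big_ltn // mulrA mulrC; congr (_ * _).
  apply: eq_big_nat => -[|[|j]] // _.
  apply: eq_bigr => b _; rewrite /position_weight /=.
  by case: (p 0%N < p 1%N)%N; rewrite mulr1.
(* The comparison of [w_1 + w_2] with 0 gives the larger of the first two entries an extra factor;
   in the doubly ascending case position 1 thus sums to [s^2 + t^2]. *)
rewrite !big_bool /position_weight /desc_at /step_weight /=.
by case: ltngtP p01 => // _ _; case: (p 2%N < p 1%N)%N => /=; ring.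
Qed.

(** If [p] ascends at the start, no comparison is charged to position 0; otherwise two are, with
    opposite outcomes, giving [s * t] for either sign. *)
Lemma position_weight0 m (p : nat -> nat) : p 0%N != p 1%N ->
  position_weight m.+2 p 0 true = position_weight m.+2 p 0 false.
Proof.
rewrite /position_weight /desc_at /step_weight /=.
by case: ltngtP => //= _ _; ring.
Qed.

(** * Gamma monomials and the degree of the tail *)

Definition gamma_monomial (d : nat) (f : K) : Prop :=
  exists a b c, f = (s * t) ^+ b * (s + t) ^+ c *+ a /\ (2 * b + c = d)%N.

Lemma gamma_monomialM d1 d2 f1 f2 : gamma_monomial d1 f1 ->
  gamma_monomial d2 f2 -> gamma_monomial (d1 + d2) (f1 * f2).
Proof.
move=> [a1 [b1 [c1 [-> <-]]]] [a2 [b2 [c2 [-> <-]]]].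
exists (a1 * a2)%N, (b1 + b2)%N, (c1 + c2)%N; split; last lia.
rewrite mulrnA !exprD mulrnAl mulrnAr -mulrnA mulnC mulrnA.
by congr (_ *+ _ *+ _); ring.
Qed.

Lemma gamma_monomial_site (asc desc : bool) :
  gamma_monomial (asc + desc) (site_weight asc desc).
Proof.
rewrite site_weightE; case: asc; case: desc => /=.
- by exists 2%N, 1%N, 0%N; split; [ring|].
- by exists 1%N, 0%N, 1%N; split; [ring|].
- by exists 1%N, 0%N, 1%N; split; [ring|].
- by exists 2%N, 0%N, 0%N; split; [ring|].
Qed.

(** Each of the [m] adjacent pairs from position 2 on adds one to the degree, whichever end is
    larger; the pair (1, 2) does so only when its larger end lies in the tail. *)
Lemma gamma_monomial_tail m (p : nat -> nat) :
  (forall i, (i < m.+2)%N -> p i != p i.+1) ->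
  gamma_monomial (m + (p 1%N < p 2%N)%N) (tail_weight m.+3 p).
Proof.
move=> p_neq.
have -> : (m + (p 1 < p 2)%N)%N =
    (\sum_(2 <= j < m.+3) ((p j.-1 < p j) + desc_at m.+3 p j))%N.
  rewrite big_split /= big_ltn // [X in _ = (_ + X)%N]big_nat_recr //=.
  rewrite /desc_at ltnn addn0 -addnA addnC; congr (_ + _)%N.
  rewrite [X in _ = (X + _)%N]big_add1 /= -big_split /=.
  rewrite (eq_big_nat _ _ (F2 := fun=> 1%N)) ?sum_nat_const_nat ?muln1 ?subSS ?subn0 //.
  move=> j /andP[_ ltj]; rewrite ltnS ltj /=.
  by case: ltngtP (p_neq j ltj).
rewrite /tail_weight.
elim/big_rec2: _ => [|j f d _ IH]; first by exists 1%N, 0%N, 0%N; rewrite mulr1.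
exact: gamma_monomialM (gamma_monomial_site _ _) IH.
Qed.

(** * The tail under rearrangement of the first entries *)

Definition fourth_between (n : nat) (p : nat -> nat) : bool :=
  [&& (3 < n)%N, (p 1%N < p 3%N)%N, (p 3%N < p 2%N)%N & ~~ desc_at n p 3].

(** Position 2 now holds [p 1] instead of [p 2], which alters comparisons only if [p 3] lies between
    these two values. *)
Lemma tail_weight_rot n (p q : nat -> nat) : (2 < n)%N ->
  (p 0%N < p 1%N < p 2%N)%N ->
  ((3 < n)%N -> p 1%N != p 3%N) -> ((3 < n)%N -> p 2%N != p 3%N) ->
  ~~ fourth_between n p -> q 1%N = p 0%N -> q 2%N = p 1%N ->
  (forall j, (2 < j < n)%N -> q j = p j) ->
  tail_weight n q = tail_weight n p.
Proof.
move=> n3 /andP[p01 p12] p13 p23 npk q1 q2 qp; rewrite /tail_weight.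
have tail : \prod_(4 <= j < n) site_weight (q j.-1 < q j)%N (desc_at n q j) =
    \prod_(4 <= j < n) site_weight (p j.-1 < p j)%N (desc_at n p j).
  apply: eq_big_nat => -[|[|[|[|j]]]] // /andP[_ ltj].
  by rewrite /desc_at /=; case: (ltnP j.+4.+1 n) => /= lt;
    rewrite !qp ?lt ?ltj ?(ltnW ltj).
have desc3 : (3 < n)%N -> desc_at n q 3 = desc_at n p 3.
  rewrite /desc_at => n4; case: (ltnP 4 n) => //= n5.
  by rewrite !qp ?n4 ?n5.
rewrite big_ltn // [RHS]big_ltn //.
case: (ltnP 3 n) => [n4|n3'].
  rewrite big_ltn // [in RHS]big_ltn // tail !mulrA; congr (_ * _).
  rewrite desc3 // {1 3}/desc_at n4 /= q1 q2 qp ?n4 // p01 p12.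
  move: npk; rewrite /fourth_between n4 /=.
  rewrite !site_weightE.
  case: (ltngtP (p 1%N) (p 3%N)) (p13 n4) => // h1 _;
  case: (ltngtP (p 2%N) (p 3%N)) (p23 n4) => // h2 _ /=; rewrite ?mulr1 //; last by lia.
  (* Here [p 3] lies between and is followed by a descent: positions 2 and 3 are a peak and a slope
     in [p], a slope and a peak in [q]. *)
  by move/negbNE=> ->; rewrite mulrC.
rewrite !big_geq // q1 q2 p01 p12; congr (site_weight _ _ * _).
by rewrite /desc_at ltnNge n3'.
Qed.

(** Every site keeps its type: position 2 stays a peak, and position 3 gets the smaller value [p 1],
    still below both neighbours (or last). *)
Lemma tail_weight_fourth_between n (p q : nat -> nat) :
  (p 0%N < p 1%N < p 2%N)%N -> fourth_between n p ->
  ((4 < n)%N -> p 3%N != p 4%N) ->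
  q 1%N = p 0%N -> q 2%N = p 2%N -> q 3%N = p 1%N ->
  (forall j, (3 < j < n)%N -> q j = p j) ->
  tail_weight n q = tail_weight n p.
Proof.
move=> /andP[p01 p12] /and4P[n4 p13 p32 nd] p34 q1 q2 q3 qp.
rewrite /tail_weight; apply: eq_big_nat.
move: nd; rewrite /desc_at => nd.
move=> [|[|[|[|[|j]]]]] // /andP[_ ltj] /=; congr site_weight.
- by rewrite q1 q2 p12 (ltn_trans p01).
- by rewrite n4 q2 q3 p12 p32.
- by rewrite q2 q3; apply/idP/idP; lia.
- case: (ltnP 4 n) nd p34 => //= n5; rewrite q3 qp ?n5 // => nd /(_ isT) p34.
  by apply/idP/idP => h; lia.
- move: nd p34; rewrite ltj q3 qp ?ltj //= => nd /(_ isT) p34.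
  by apply/idP/idP => h; lia.
- by case: (ltnP 5 n) => //= n6; rewrite !qp ?n6 ?ltj.
- by rewrite !qp ?ltj ?(ltnW ltj).
- by case: (ltnP j.+4.+2 n) => //= n6; rewrite !qp ?n6 ?ltj.
Qed.

End SiteWeights.

(** * Signed permutations as permutations with signs *)

Definition signed_int (b : bool) (k : nat) : int := if b then - k.+1%:Z else k.+1%:Z.

Lemma signed_int_lt b1 k1 b2 k2 : k1 != k2 ->
  (signed_int b2 k2 < signed_int b1 k1) = if (k1 < k2)%N then b2 else ~~ b1.
Proof. by case: b1; case: b2; rewrite /signed_int; case: ltngtP => //=; lia. Qed.

Lemma signed_intN b k : - signed_int b k = signed_int (~~ b) k.
Proof. by case: b; rewrite /signed_int //= opprK. Qed.

Lemma signed_int_lt0 b k : (signed_int b k < 0) = b.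
Proof. by case: b; rewrite /signed_int; lia. Qed.

Section SignedPerm.
Variable n : nat.
Implicit Types (p : 'S_n) (e : {ffun 'I_n -> bool}) (w : {perm (pm n)}).

Definition signed_fun p e (x : pm n) : pm n := (x.1 (+) e x.2, p x.2).

Lemma signed_fun_inj p e : injective (signed_fun p e).
Proof.
by move=> [b i] [c j] [] /= + /perm_inj eij; rewrite eij => /addIb ->.
Qed.

Definition signed_perm p e := perm (@signed_fun_inj p e).

Lemma signed_perm_inj : injective (fun x => signed_perm x.1 x.2).
Proof.
move=> [p e] [p' e'] /= /permP eqw.
have eq_val i : (e i, p i) = (e' i, p' i) by move: (eqw (false, i)); rewrite !permE.
by congr pair; [apply/permP | apply/ffunP] => i; case: (eq_val i).
Qed.

Lemma signed_permsE : signed_perms n =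
  [set signed_perm x.1 x.2 | x in [set: 'S_n * {ffun 'I_n -> bool}]].
Proof.
apply/setP => w; rewrite inE; apply/forallP/imsetP => [w_opp|[[p e] _ ->] x].
  have {}w_opp x : w (pm_opp x) = pm_opp (w x) by apply/eqP.
  have f_inj : injective (fun i => (w (false, i)).2).
    move=> i j eqf; case: (eqVneq (w (false, i)).1 (w (false, j)).1) => eqs.
      suff /perm_inj[] : w (false, i) = w (false, j) by [].
      by move: eqf eqs; case: (w _) => ? ?; case: (w _) => ? ? /= -> ->.
    suff /perm_inj[] : w (false, i) = w (true, j) by [].
    rewrite -[(true, j)]/(pm_opp (false, j)) w_opp /pm_opp -eqf.
    by move: eqs; case: (w _) => -[] ?; case: (w _) => -[] ?.
  exists (perm f_inj, [ffun i => (w (false, i)).1]); first by rewrite inE.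
  apply/permP => -[b i]; rewrite permE /signed_fun /= permE ffunE.
  case: b => /=; last by case: (w _).
  by rewrite -[(true, i)]/(pm_opp (false, i)) w_opp.
by rewrite !permE /pm_opp /signed_fun /= addNb.
Qed.

Lemma sum_signed_perms (V : nmodType) (P : pred {perm (pm n)})
    (F : {perm (pm n)} -> V) :
  \sum_(w in signed_perms n | P w) F w =
  \sum_(p : 'S_n) \sum_(e | P (signed_perm p e)) F (signed_perm p e).
Proof.
rewrite signed_permsE big_imset_cond /=; last by move=> x y _ _ /signed_perm_inj.
by rewrite pair_big_dep; apply: eq_bigl => x; rewrite inE.
Qed.

Lemma nth_one_line p e (i : 'I_n) :
  (one_line (signed_perm p e))`_i = signed_int (e i) (p i).
Proof. by rewrite (nth_map i) ?size_enum_ord // nth_ord_enum permE. Qed.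

Lemma negs_signed_perm p e : negs (signed_perm p e) = (\sum_i e i)%N.
Proof.
rewrite /negs -sum1dep_card big_mkcond; apply: eq_bigr => i _.
by rewrite nth_one_line signed_int_lt0; case: (e i).
Qed.

(* The product is the Vandermonde determinant of the nodes permuted by [p]. *)
Lemma sgr_prod_perm p :
  Num.sg (\prod_(i < n) \prod_(j < n | (i < j)%N) ((p j)%:Z - (p i)%:Z)) = (-1) ^+ p.
Proof.
pose a : 'rV[int]_n := \row_i i%:Z.
have -> : \prod_(i < n) \prod_(j < n | (i < j)%N) ((p j)%:Z - (p i)%:Z) =
    \det (Vandermonde n (col_perm p a)).
  rewrite det_Vandermonde; apply: eq_bigr => i _; apply: eq_bigr => j _.
  by rewrite !mxE.
have -> : Vandermonde n (col_perm p a) = col_perm p (Vandermonde n a).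
  by apply/matrixP => i j; rewrite !mxE.
rewrite col_permE det_mulmx det_perm odd_permV sgrM gtr0_sg ?mul1r.
  by case: odd_perm; rewrite ?expr0 ?expr1 ?sgrN ?sgr1.
rewrite det_Vandermonde; apply: prodr_gt0 => i _; apply: prodr_gt0 => j ltij.
by rewrite !mxE subr_gt0 ltz_nat.
Qed.

(** For a pair [i < j] with [p i < p j], both comparisons follow the sign of entry [j], so they
    count 0 or 2; if [p i > p j], exactly one of them holds. *)
Lemma odd_invD_signed_perm p e : odd (invD (signed_perm p e)) = p.
Proof.
apply: (@signr_inj int); rewrite signr_odd -sgr_prod_perm.
rewrite pair_big_dep /= (big_morph (@Num.sg _) (@sgrM _) (@sgr1 _)) /=.
rewrite /invD -!sum1dep_card !big_mkcondr -big_split /= -prodrXr.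
apply: eq_bigr => -[i j] /= ltij.
have p_neq : p i != p j :> nat.
  by rewrite val_eqE (inj_eq perm_inj) -val_eqE; case: ltngtP ltij.
rewrite !nth_one_line signed_intN !signed_int_lt //.
case: ltngtP p_neq => // ltp _; last first.
  rewrite negbK ltr0_sg ?subr_lt0 ?ltz_nat //.
  by case: (e i).
rewrite gtr0_sg ?subr_gt0 ?ltz_nat //.
by case: (e j).
Qed.

End SignedPerm.

(** * Descent weights summed over signs *)

Section DescentWeight.
Variables (K : comNzRingType) (s t : K) (m : nat).
Implicit Types (p : 'S_m.+3) (e : {ffun 'I_m.+3 -> bool}).

Definition perm_nat p (k : nat) : nat := p (inord k).

Lemma perm_nat_neq p i j : (i < m.+3)%N -> (j < m.+3)%N -> i != j ->
  perm_nat p i != perm_nat p j.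
Proof.
move=> lti ltj; apply: contraNN.
by rewrite val_eqE (inj_eq perm_inj) -val_eqE /= !inordK.
Qed.

Lemma desD_signed_perm p e :
  let q := perm_nat p in let f k : bool := e (inord k) in
  desD (signed_perm p e) =
  (\sum_(i < m.+2) (if (q i < q i.+1)%N then f i.+1 else ~~ f i) +
   f (q 0%N < q 1%N)%N)%N.
Proof.
move=> q f.
have nth k : (k < m.+3)%N ->
    (one_line (signed_perm p e))`_k = signed_int (f k) (q k).
  by move=> ltk; rewrite -[in LHS](inordK ltk) nth_one_line.
congr (_ + nat_of_bool _)%N.
  rewrite -sum1dep_card big_mkcond; apply: eq_bigr => -[i /= lti] _.
  have lti' : (i < m.+3)%N := ltnW lti.
  rewrite !nth // signed_int_lt ?perm_nat_neq ?ltn_eqF //.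
(* Read as [w_2 < - w_1], the sum condition becomes a comparison of signed entries. *)
rewrite !nth // addrC -ltrBrDr sub0r signed_intN signed_int_lt ?perm_nat_neq //.
by case: ifP => _; rewrite ?negbK.
Qed.

Lemma descent_weight p e :
  t ^+ desD (signed_perm p e) * s ^+ ascD (signed_perm p e) =
  \prod_(j < m.+3) position_weight s t m.+3 (perm_nat p) j (e j).
Proof.
pose q := perm_nat p; pose f k : bool := e (inord k).
(* The sum condition is appended as a last step, making [m.+3] steps, so that [ascD] counts the
   non-descents. *)
pose d i := if (i < m.+2)%N then if (q i < q i.+1)%N then f i.+1 else ~~ f i
            else f (q 0%N < q 1%N)%N.
have desE : desD (signed_perm p e) = (\sum_(i < m.+3) d i)%N.
  rewrite desD_signed_perm [RHS]big_ord_recr /= /d ltnn; congr (_ + _)%N.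
  by apply: eq_bigr => i _; rewrite ltn_ord; case: ifP.
rewrite /ascD desE -prod_step_weight big_ord_recr /= /d ltnn.
transitivity (\prod_(j < m.+3) position_weight s t m.+3 q j (f j)).
  rewrite prod_position_weight; last by move=> i lti; rewrite perm_nat_neq ?ltn_eqF // ltnW.
  by congr (_ * _); apply: eq_bigr => i _; rewrite ltn_ord.
by apply: eq_bigr => j _; rewrite /f inord_val.
Qed.

Definition head_weight (p : nat -> nat) : K :=
  if (p 2%N < p 1%N)%N then s * t * (s + t) *+ 2
  else if (p 0%N < p 1%N)%N then ((s + t) ^+ 2 - s * t *+ 2) *+ 2
  else s * t *+ 4.

Lemma sum_Dset_parity (c : bool) :
  (\sum_(w in Dset m.+3 | odd (invD w) == c) t ^+ desD w * s ^+ ascD w) *+ 2 =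
  \sum_(p : 'S_m.+3 | (p : bool) == c)
    tail_weight s t m.+3 (perm_nat p) * head_weight (perm_nat p).
Proof.
under eq_bigl => w do rewrite inE -andbA.
rewrite sum_signed_perms -sumrMnl [RHS]big_mkcond /=; apply: eq_bigr => p _.
under eq_bigl => e do rewrite negs_signed_perm odd_invD_signed_perm.
under eq_bigr => e _ do rewrite descent_weight.
case: eqP => _; last by rewrite big_pred0 ?mul0rn // => e; rewrite andbF.
under eq_bigl => e do rewrite andbT.
have p01 : perm_nat p 0 != perm_nat p 1 by rewrite perm_nat_neq.
rewrite (sum_even_signs (g := fun j b => position_weight s t m.+3 (perm_nat p) j b)).
  exact: prod_sum_position_weight.
exact: position_weight0.
Qed.

End DescentWeight.

(** * The parity-preserving cancellation *)

Section Cancellation.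
Variables (K : comNzRingType) (s t : K) (m : nat).
Implicit Types (p : 'S_m.+3).

(** For [1 < k < m.+3] this is a 3-cycle, hence even; composed with [p], it brings entry [k] to the
    front and entries 0 and 1 to positions 1 and [k]. *)
Definition rot_positions (k : nat) : 'S_m.+3 :=
  (tperm ord0 (inord k) * tperm ord0 (inord 1))%g.

Lemma odd_rot_positions k p : (0 < k < m.+3)%N ->
  (rot_positions k * p)%g = p :> bool.
Proof.
move=> /andP[k0 ltk]; rewrite /rot_positions !odd_permM !odd_tperm -!val_eqE /=.
by rewrite !inordK // (ltn_eqF k0).
Qed.

Lemma perm_nat_rot k p j : (1 < k < m.+3)%N -> (j < m.+3)%N ->
  perm_nat (rot_positions k * p)%g j =
  perm_nat p (if j == 0 then k else if j == 1 then 0 else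
              if j == k then 1 else j)%N.
Proof.
move=> /andP[k1 ltk] ltj; rewrite /perm_nat !permM; congr (nat_of_ord (p _)).
have ord0E : ord0 = inord 0 :> 'I_m.+3 by apply/val_inj; rewrite /= inordK.
have inord_neq a b : (a < m.+3)%N -> (b < m.+3)%N -> a != b ->
    inord a != inord b :> 'I_m.+3.
  by move=> lta ltb; rewrite -val_eqE /= !inordK.
rewrite ord0E; case: eqVneq => [->|j0].
  by rewrite tpermL tpermD // inord_neq //; lia.
case: (eqVneq j 1%N) => [->|j1].
  by rewrite (@tpermD _ _ (inord k)) ?tpermR // inord_neq //; lia.
case: (eqVneq j k) => [->|jk]; first by rewrite tpermR tpermL.
by rewrite !tpermD // inord_neq //; lia.
Qed.

Definition swap_head p : 'S_m.+3 :=
  (rot_positions (if fourth_between m.+3 (perm_nat p) then 3 else 2)%N * p)%g.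

Definition up_up p : bool := (perm_nat p 0 < perm_nat p 1 < perm_nat p 2)%N.
Definition down_up p : bool :=
  (perm_nat p 1 < perm_nat p 0)%N && (perm_nat p 1 < perm_nat p 2)%N.

Lemma fourth_between_gt p : fourth_between m.+3 (perm_nat p) -> (3 < m.+3)%N.
Proof. by case/and4P. Qed.

Lemma odd_swap_head p : swap_head p = p :> bool.
Proof.
by rewrite odd_rot_positions //; case: ifP => // /fourth_between_gt ->.
Qed.

Lemma down_up_swap_head p : up_up p -> down_up (swap_head p).
Proof.
rewrite /up_up /down_up /swap_head => /andP[p01 p12].
case: ifP => [lp|_]; last by rewrite !perm_nat_rot //= (ltn_trans p01) ?p01.
have n4 := fourth_between_gt lp; case/and4P: lp => _ p13 p32 _.
by rewrite !perm_nat_rot ?n4 //= !(ltn_trans p01).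
Qed.

Lemma tail_weight_swap_head p : up_up p ->
  tail_weight s t m.+3 (perm_nat (swap_head p)) = tail_weight s t m.+3 (perm_nat p).
Proof.
rewrite /up_up /swap_head => upp; case: ifP => [lp|/negbT nlp].
  have n4 := fourth_between_gt lp.
  apply: tail_weight_fourth_between; rewrite ?perm_nat_rot ?n4 //.
    by move=> n5; rewrite perm_nat_neq.
  move=> j /andP[j3 ltj]; rewrite perm_nat_rot ?n4 //.
  by case: j j3 {ltj} => [|[|[|[|j]]]].
apply: tail_weight_rot; rewrite ?perm_nat_rot //.
- by move=> n4; rewrite perm_nat_neq.
- by move=> n4; rewrite perm_nat_neq.
move=> j /andP[j3 ltj]; rewrite perm_nat_rot //.
by case: j j3 {ltj} => [|[|[|j]]].
Qed.

Lemma swap_head_inj : {in up_up &, injective swap_head}.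
Proof.
have neq p p' : up_up p' -> fourth_between m.+3 (perm_nat p) ->
    (rot_positions 3 * p != rot_positions 2 * p')%g.
  move=> /andP[_ p12] lp; have n4 := fourth_between_gt lp.
  case/and4P: lp => _ _ p32 _; apply/eqP => eqr.
  (* Comparing the first and third entries of the image tells which of the two rotations was
     applied. *)
  have := congr1 (fun r => perm_nat r 0 < perm_nat r 2)%N eqr.
  by rewrite !perm_nat_rot ?n4 //= p32 ltnNge ltnW.
move=> p p' upp upp'; rewrite /swap_head; case: ifP => lp; case: ifP => lp'.
- by move/mulgI.
- by move/eqP; rewrite (negPf (neq p p' upp' lp)).
- by move/esym/eqP; rewrite (negPf (neq p' p upp lp')).
- by move/mulgI.
Qed.

Lemma sum_head_weight (c : bool) :
  let X p := tail_weight s t m.+3 (perm_nat p) in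
  let S := [set p : 'S_m.+3 | ((p : bool) == c) && up_up p] in
  let T := [set p : 'S_m.+3 | ((p : bool) == c) && down_up p] in
  \sum_(p : 'S_m.+3 | (p : bool) == c) X p * head_weight s t (perm_nat p) =
  \sum_(p : 'S_m.+3 | ((p : bool) == c) && (perm_nat p 2 < perm_nat p 1)%N)
     X p * (s * t * (s + t) *+ 2) +
  \sum_(p in S) X p * ((s + t) ^+ 2 *+ 2) +
  \sum_(p in T :\: swap_head @: S) X p * (s * t *+ 4).
Proof.
move=> X S T.
have subT : swap_head @: S \subset T.
  apply/subsetP => _ /imsetP[p + ->]; rewrite !inE => /andP[pc upp].
  by rewrite odd_swap_head pc down_up_swap_head.
have sumT : \sum_(p in T) X p * (s * t *+ 4) =
    \sum_(p in S) X p * (s * t *+ 4) +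
    \sum_(p in T :\: swap_head @: S) X p * (s * t *+ 4).
  rewrite (big_setID (swap_head @: S)) /= (setIidPr subT); congr (_ + _).
  rewrite big_imset /=; last first.
    by move=> p p'; rewrite !inE => /andP[_ ?] /andP[_ ?]; apply: swap_head_inj.
  apply: eq_bigr => p; rewrite inE => /andP[_ upp].
  by rewrite /X tail_weight_swap_head.
rewrite (bigID (fun p => perm_nat p 2 < perm_nat p 1)%N) /= -addrA.
congr (_ + _).
  by apply: eq_bigr => p /andP[_ p21]; rewrite /head_weight p21.
(* With [4 s t] added over [S], the negative terms on the left vanish, and on the right the image of
   [S] completes the sum over [T]. *)
apply: (addrI (\sum_(p in S) X p * (s * t *+ 4))).
rewrite [RHS]addrCA -sumT [X in _ + X = _](bigID (fun p => perm_nat p 0 < perm_nat p 1)%N) /=.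
rewrite addrA; congr (_ + _).
  rewrite [X in _ + X = _](eq_bigl (mem S)); last first.
    move=> p /=; rewrite inE -andbA; congr (_ && _).
    rewrite /up_up andbC; congr (_ && _).
    by case: ltngtP (@perm_nat_neq m p 1 2 isT isT isT).
  rewrite -big_split; apply: eq_bigr => p; rewrite inE => /and3P[_ p01 p12] /=.
  by rewrite /head_weight p01 ltnNge ltnW //=; ring.
apply: eq_big => p; last first.
  by move=> /andP[/andP[_ /negPf p21] /negPf p01]; rewrite /head_weight p21 p01.
rewrite inE -andbA; congr (_ && _); rewrite /down_up andbC; congr (_ && _).
  by case: ltngtP (@perm_nat_neq m p 0 1 isT isT isT).
by case: ltngtP (@perm_nat_neq m p 1 2 isT isT isT).
Qed.

End Cancellation.

(** * The cone of gamma non-negative polynomials *)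

Lemma gamma_nonneg_monomial n f :
  gamma_monomial var_s var_t n f -> gamma_nonneg n f.
Proof.
move=> [a [b [c [-> eqn]]]].
have ltb : (b < n./2.+1)%N by lia.
exists (fun i => if i == Ordinal ltb then a%:R else 0); split.
  by move=> i; case: ifP.
rewrite (bigD1 (Ordinal ltb)) //= eqxx big1 => [|i /negPf ->]; last by rewrite scale0r.
have -> : (n - 2 * b = c)%N by lia.
by rewrite addr0 scaler_nat.
Qed.

Lemma gamma_nonneg0 n : gamma_nonneg n 0.
Proof.
by exists (fun=> 0); split=> //; rewrite big1 // => i _; rewrite scale0r.
Qed.

Lemma gamma_nonnegD n f g :
  gamma_nonneg n f -> gamma_nonneg n g -> gamma_nonneg n (f + g).
Proof.
move=> [a [a_ge0 ->]] [b [b_ge0 ->]]; exists (fun i => a i + b i); split.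
  by move=> i; apply: addr_ge0.
by rewrite -big_split; apply: eq_bigr => i _; rewrite scalerDl.
Qed.

Lemma gamma_nonnegZ n (c : rat) f :
  0 <= c -> gamma_nonneg n f -> gamma_nonneg n (c *: f).
Proof.
move=> c_ge0 [a [a_ge0 ->]]; exists (fun i => c * a i); split.
  by move=> i; apply: mulr_ge0.
by rewrite scaler_sumr; apply: eq_bigr => i _; rewrite scalerA.
Qed.

Lemma gamma_nonneg_sum n (I : finType) (P : pred I) (F : I -> {mpoly rat[2]}) :
  (forall i, P i -> gamma_monomial var_s var_t n (F i)) ->
  gamma_nonneg n (\sum_(i | P i) F i).
Proof.
move=> FP; apply: (big_ind (gamma_nonneg n)).
- exact: gamma_nonneg0.
- exact: gamma_nonnegD.
- by move=> i /FP/gamma_nonneg_monomial.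
Qed.

Lemma gamma_nonneg_Dset_parity m (c : bool) :
  gamma_nonneg m.+3 (\sum_(w in Dset m.+3 | odd (invD w) == c)
                       var_t ^+ desD w * var_s ^+ ascD w).
Proof.
set f := (\sum_(w in _ | _) _).
have -> : f = (2%:R^-1 : rat) *: (f *+ 2).
  by rewrite -scaler_nat scalerA mulVf ?scale1r.
apply: gamma_nonnegZ => //; rewrite /f sum_Dset_parity sum_head_weight.
(* The head must supply the missing degree [d]: 3 when [p] descends from position 1 to 2, and 2 when
   it ascends. *)
have tail (p : 'S_m.+3) d g : (m + (perm_nat p 1 < perm_nat p 2)%N + d = m.+3)%N ->
    gamma_monomial var_s var_t d g ->
    gamma_monomial var_s var_t m.+3
      (tail_weight var_s var_t m.+3 (perm_nat p) * g).
  move=> eqd gP; rewrite -[X in gamma_monomial _ _ X]eqd.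
  apply: gamma_monomialM gP; apply: gamma_monomial_tail => i lti.
  by rewrite perm_nat_neq ?ltn_eqF // ltnW.
apply: gamma_nonnegD; first apply: gamma_nonnegD; apply: gamma_nonneg_sum => p.
- move=> /andP[_ p21]; apply: (tail _ 3%N).
    by rewrite ltnNge ltnW //= addn0 addn3.
  by exists 2%N, 1%N, 1%N; rewrite !expr1.
- rewrite inE => /and3P[_ _ p12]; apply: (tail _ 2%N); first by rewrite p12; lia.
  by exists 2%N, 0%N, 2%N; rewrite expr0 mul1r.
- rewrite !inE => /and4P[_ _ _ p12]; apply: (tail _ 2%N); first by rewrite p12; lia.
  by exists 4%N, 1%N, 0%N; rewrite expr0 expr1 mulr1.
Qed.

Theorem theorem35 (n : nat) (hn : (3 <= n)%N) :
  gamma_nonneg n (Dpoly_plus n) /\ gamma_nonneg n (Dpoly_minus n).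
Proof.
case: n hn => [|[|[|m]]] // _; split.
  rewrite /Dpoly_plus (eq_bigl (fun w => (w \in Dset m.+3) && (odd (invD w) == false))).
    exact: gamma_nonneg_Dset_parity.
  by move=> w; rewrite !inE eqbF_neg.
rewrite /Dpoly_minus (eq_bigl (fun w => (w \in Dset m.+3) && (odd (invD w) == true))).
  exact: gamma_nonneg_Dset_parity.
move=> w; rewrite in_setD [w \in Dplus _]inE eqb_id.
by case: (w \in Dset _); case: odd.
Qed.
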